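(* Let $n\ge2$ be an integer, and let $\mathcal C^{(B)}_{n,t}$, $\mathcal C^{(A)}_{n,t}$ ($0\le t\le n-1$) be the numbers defined in the context, i.e. the coefficients (up to normalization) of the even polynomials $$\Xi_n(x)=\frac{(-1)^{n+1}}{2^{4n-2}(2n-1)!}\sum_{t=0}^{n-1} \mathcal C^{(B)}_{n,t}\,x^{2t},\qquad \Lambda_n(x)=\frac{2(-1)^{n+1}}{(2^{2n+1}-1)(2n)!}\sum_{t=0}^{n-1} \mathcal C^{(A)}_{n,t}\,x^{2t}.$$ Then the sequences $\bigl(|\mathcal C^{(B)}_{n,t}|\bigr)_{t=0}^{n-1}$ and $\bigl(|\mathcal C^{(A)}_{n,t}|\bigr)_{t=0}^{n-1}$ are log-concave and hence unimodal.
   Context: A finite sequence $(a_t)_{t=0}^{N}$ of nonnegative reals is log-concave if $a_t^2\ge a_{t-1}a_{t+1}$ for $1\le t\le N-1$, and unimodal if it is weakly increasing up to some index and weakly decreasing afterwards. Binomial coefficients satisfy $\binom{m}{\ell}=0$ whenever $\ell<0$ or $\ell>m$. The Eulerian number of type $A$, $\left\langle{m\atop k}\right\rangle$ ($m\ge1$, $0\le k\le m-1$), is the number of permutations of $\{1,\dots,m\}$ with exactly $k$ descents; equivalently $\sum_{j\ge0}(j+1)^m x^j=(1-x)^{-m-1}\sum_{k=0}^{m-1}\left\langle{m\atop k}\right\rangle x^k$ for $|x|<1$. The Eulerian number of type $B$, $\left\langle{m\atop k}\right\rangle^{B}$ ($m\ge0$, $0\le k\le m$), is determined by $\sum_{j\ge0}(2j+1)^m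 x^j=(1-x)^{-m-1}\sum_{k=0}^{m}\left\langle{m\atop k}\right\rangle^{B} x^k$ for $|x|<1$. For $n\ge1$ and $0\le t\le n-1$, $$\mathcal C^{(B)}_{n,t}:=\sum_{k=0}^{n-1}\left\langle {2n-1 \atop k}\right\rangle^{B}(-1)^{k}\sum_{i=0}^{k}(-1)^i\binom{k}{i}\binom{2n-2k-1}{2t-2i+1},\quad \mathcal C^{(A)}_{n,t}:=\sum_{k=0}^{n-1}\left\langle {2n \atop k}\right\rangle(-1)^{k}\sum_{i=0}^{k}(-1)^i\binom{k}{i}\binom{2n-2k-1}{2t-2i+1}.$$ *)

(* Defs.v *)
From mathcomp Require Import all_boot all_order all_algebra all_fingroup.
From mathcomp Require Import all_classical all_reals all_analysis.
From mathcomp Require Import zify ring lra.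

Set Implicit Arguments.
Unset Strict Implicit.
Unset Printing Implicit Defensive.

Import Order.TTheory GRing.Theory Num.Theory.
Import numFieldNormedType.Exports.

Local Open Scope classical_set_scope.
Local Open Scope ring_scope.

Definition log_concave (R : realType) (N : nat) (a : nat -> R) : Prop :=
  forall t : nat, (1 <= t)%N -> (t <= N - 1)%N ->
    a t.-1 * a t.+1 <= a t ^+ 2.

Definition unimodal (R : realType) (N : nat) (a : nat -> R) : Prop :=
  exists2 p : nat, (p <= N)%N &
    (forall t : nat, (t < p)%N -> a t <= a t.+1) /\
    (forall t : nat, (p <= t)%N -> (t < N)%N -> a t.+1 <= a t).

(* The type ['S_m] permutes [{0, ..., m-1}] instead of [{1, ..., m}]. *)
Definition descents (m : nat) (s : 'S_m) : {set 'I_m} :=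
  [set i : 'I_m | [exists j : 'I_m, (j == i.+1 :> nat) && (s j < s i)%N]].

Definition eulerianA (m k : nat) : nat :=
  #|[set s : 'S_m | #|descents s| == k]|.

(* [b] is extended by 0 outside [{0, ..., m}], so that it is determined by its
   generating function (see [eulerianB_gf_uniq]). *)
Definition eulerianB_gf (R : realType) (m : nat) (b : nat -> R) : Prop :=
  (forall k : nat, (m < k)%N -> b k = 0) /\
  (forall x : R, `|x| < 1 ->
     [series (2 * j + 1)%:R ^+ m * x ^+ j]_j @ \oo -->
       (1 - x) ^- m.+1 * \sum_(0 <= k < m.+1) b k * x ^+ k).

(* The default value of [xget] is never used: see [eulerianBP]. *)
Definition eulerianB (R : realType) (m : nat) : nat -> R :=
  xget (fun=> 0) [set b : nat -> R | eulerianB_gf m b].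

(* The lower index is an integer because it may be negative in the double sums
   below, where truncated subtraction would give wrong values. *)
Definition binz (m : nat) (l : int) : nat :=
  if l is Posz l' then 'C(m, l') else 0%N.

Definition calC (R : realType) (E : nat -> R) (n t : nat) : R :=
  \sum_(0 <= k < n) E k * (-1) ^+ k *
    \sum_(0 <= i < k.+1) (-1) ^+ i * 'C(k, i)%:R *
      (binz (2 * n - 2 * k - 1) ((2 * t)%:Z - (2 * i)%:Z + 1))%:R.

Definition calCB (R : realType) (n t : nat) : R :=
  calC (eulerianB R (2 * n - 1)) n t.

Definition calCA (R : realType) (n t : nat) : R :=
  calC (fun k => (eulerianA (2 * n) k)%:R) n t.

Lemma eulerianB_gf_uniq (R : realType) (m : nat) (b c : nat -> R) :
  eulerianB_gf m b -> eulerianB_gf m c -> b = c.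
Proof.
move=> [b0 bP] [c0 cP].
pose p : {poly R} := \poly_(k < m.+1) (b k - c k).
have p0 : p = 0.
  apply/eqP; apply: contraT => pn0.
  pose rs : seq R := [seq (i.+2)%:R^-1 | i <- iota 0 m.+1].
  have urs : uniq rs.
    rewrite map_inj_uniq ?iota_uniq // => i j /invr_inj /eqP.
    by rewrite eqr_nat => /eqP [].
  have ars : all (root p) rs.
    apply/allP => _ /mapP[i _ ->]; set x : R := _^-1.
    have x1 : `|x| < 1.
      by rewrite ger0_norm ?invr_ge0 // invf_lt1 ?ltr1n ?ltr0n.
    have xn : (1 - x) ^- m.+1 != 0.
      rewrite invr_eq0 expf_neq0 // subr_eq0 eq_sym.
      by apply: contraTneq x1 => ->; rewrite normr1 ltxx.
    have e := mulfI xn (cvg_unique (@norm_hausdorff _ _) (bP x x1) (cP x x1)).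
    rewrite /root horner_poly -subr_eq0 subr0.
    rewrite (eq_bigr (fun k : 'I_m.+1 => b k * x ^+ k - c k * x ^+ k)); last first.
      by move=> k _; rewrite mulrBl.
    by rewrite big_split /= sumrN -!(big_mkord xpredT (fun k => _ k * x ^+ k)) e subrr.
  have := max_poly_roots pn0 ars urs.
  by rewrite size_map size_iota => h; have := leq_trans h (size_poly _ _); rewrite ltnn.
apply/funext => k; have [mk|km] := ltnP m k; first by rewrite b0 // c0.
by apply/eqP; rewrite -subr_eq0; move/polyP/(_ k): p0; rewrite coef_poly ltnS km coef0 => ->.
Qed.

Fixpoint eulerianB_rec (m k : nat) : nat :=
  if m is m'.+1 then
    ((2 * k + 1) * eulerianB_rec m' k +
     (if k is k'.+1 then (2 * (m' - k') + 1) * eulerianB_rec m' k' else 0))%N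
  else (k == 0)%N.

Lemma eulerianB_rec_gt (m k : nat) : (m < k)%N -> eulerianB_rec m k = 0%N.
Proof.
elim: m k => [|m IH] [|k] //= mk.
by rewrite !IH ?muln0 //; apply: ltnW.
Qed.

Lemma eulerianB_rec_worpitzky (m j : nat) :
  ((2 * j + 1) ^ m =
   \sum_(0 <= k < m.+1) eulerianB_rec m k * 'C(j + m - k, m))%N.
Proof.
elim: m => [|m IH]; first by rewrite big_nat1 /= bin0.
rewrite expnS IH big_distrr /=.
transitivity (\sum_(0 <= k < m.+1)
  ((2 * k + 1) * eulerianB_rec m k * 'C(j + m.+1 - k, m.+1) +
   (2 * (m - k) + 1) * eulerianB_rec m k * 'C(j + m - k, m.+1)))%N.
  rewrite !big_nat; apply: eq_bigr => k /andP[_]; rewrite ltnS => km.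
  have -> : (j + m.+1 - k = (j + m - k).+1)%N by lia.
  set a := (j + m - k)%N.
  suff e : ((2 * j + 1) * 'C(a, m) =
    (2 * k + 1) * 'C(a.+1, m.+1) + (2 * (m - k) + 1) * 'C(a, m.+1))%N.
    by rewrite mulnCA e; ring.
  have [am|ma] := ltnP a m; first by rewrite !bin_small ?muln0 // ltnW.
  apply/eqP; rewrite -(eqn_pmul2l (ltn0Sn m)); apply/eqP.
  rewrite mulnDr !(mulnCA m.+1 _ (binomial _ m.+1)).
  rewrite -mul_bin_diag /= mul_bin_left.
  have [q mE] : exists q, m = (k + q)%N by exists (m - k)%N; lia.
  have [r jE] : exists r, j = (k + r)%N by exists (j - k)%N; lia.
  have -> : (m - k = q)%N by lia.
  have -> : (a - m = r)%N by lia.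
  have -> : a = (k + q + r)%N by lia.
  by rewrite mE jE; ring.
rewrite big_split /= [RHS](eq_bigr (fun k =>
  (2 * k + 1) * eulerianB_rec m k * 'C(j + m.+1 - k, m.+1) +
  (if k is k'.+1 then (2 * (m - k') + 1) * eulerianB_rec m k' else 0)
    * 'C(j + m.+1 - k, m.+1))%N); last by move=> k _; rewrite mulnDl.
rewrite big_split /=; congr addn.
  by rewrite [RHS]big_nat_recr //= eulerianB_rec_gt // muln0 mul0n addn0.
rewrite [RHS]big_nat_recl //= mul0n add0n; apply: eq_bigr => k _.
by rewrite (addnS j m) subSS.
Qed.

Lemma cvg_bin_expr (R : realType) (d : nat) (x : R) : `|x| < 1 ->
  (fun N => 'C(N + d, d)%:R * x ^+ N) @ \oo --> (0 : R).
Proof.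
move=> x1; pose y := (1 + `|x|) / 2.
have y0 : 0 < y by rewrite /y; have := normr_ge0 x; lra.
have y1 : 0 < 1 - y by rewrite /y; lra.
have xy : `|x| < y by rewrite /y; lra.
apply/norm_cvg0P.
apply: (@squeeze_cvgr _ _ _ _ (cst 0)
  (fun N => (1 - y) ^- d * (`|x| / y) ^+ N)); last 2 first.
- exact: cvg_cst.
- rewrite -[X in _ --> X](mulr0 ((1 - y) ^- d)).
  apply: cvgMl_tmp; apply: cvg_expr.
  by rewrite normrM normfV normr_id (gtr0_norm y0) ltr_pdivrMr // mul1r.
near=> N; rewrite normr_ge0 /= normrM normrX normr_nat expr_div_n.
rewrite mulrCA [leLHS]mulrC.
apply: ler_wpM2l; first exact: exprn_ge0.
rewrite -invfM.
rewrite -[leRHS]mul1r ler_pdivlMr ?mulr_gt0 ?exprn_gt0 //.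
have -> : 'C(N + d, d)%:R * ((1 - y) ^+ d * y ^+ N) =
    y ^+ N * (1 - y) ^+ d *+ 'C(N + d, d) :> R.
  by rewrite mulr_natl mulrC.
have e1 : (y + (1 - y)) ^+ (N + d) = 1 by rewrite addrC subrK expr1n.
have dN : (d < (N + d).+1)%N by rewrite ltnS leq_addl.
rewrite -[leRHS]e1 [leRHS]exprDn (bigD1 (Ordinal dN)) //= addnK.
rewrite lerDl sumr_ge0 // => i _.
by rewrite mulrn_wge0 // mulr_ge0 // exprn_ge0 // ltW.
Unshelve. all: by end_near. Qed.

Lemma cvg_series_bin (R : realType) (d : nat) (x : R) : `|x| < 1 ->
  [series 'C(j + d, d)%:R * x ^+ j]_j @ \oo --> (1 - x) ^- d.+1.
Proof.
move=> x1; have x10 : 1 - x != 0.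
  by rewrite subr_eq0 eq_sym; apply: contraTneq x1 => ->; rewrite normr1 ltxx.
elim: d => [|d IH].
  have := @cvg_geometric_series R 1 x x1; rewrite expr1 mul1r.
  suff -> : series (geometric 1 x) = [series 'C(j + 0, 0)%:R * x ^+ j]_j by [].
  by apply/funext => N; apply: eq_bigr => j _ /=; rewrite bin0.
have e N : [series 'C(j + d.+1, d.+1)%:R * x ^+ j]_j N = (1 - x)^-1 *
    ([series 'C(j + d, d)%:R * x ^+ j]_j N - 'C(N + d, d.+1)%:R * x ^+ N).
  apply: (mulfI x10); rewrite [RHS]mulVKf // /series /=.
  elim: N => [|N IHN].
    by rewrite !big_nil mulr0 add0n bin_small // mul0r subr0.
  rewrite !big_nat_recr //= mulrDr IHN addnS addSn [in RHS]binS binS.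
  by rewrite !natrD exprS; ring.
rewrite (funext e).
have -> : (1 - x) ^- d.+2 = (1 - x)^-1 * ((1 - x) ^- d.+1 - 0).
  by rewrite subr0 exprS invfM.
apply: cvgMl_tmp; apply: cvgB => //.
apply/norm_cvg0P; apply: (@squeeze_cvgr _ _ _ _ (cst 0)
  (fun N => `|'C(N + d.+1, d.+1)%:R * x ^+ N|)); last 2 first.
- exact: cvg_cst.
- by apply/norm_cvg0P; exact: cvg_bin_expr.
near=> N; rewrite normr_ge0 /= !normrM ler_wpM2r // !normr_nat ler_nat.
by rewrite addnS binS leq_addr.
Unshelve. all: by end_near. Qed.

Lemma cvg_series_bin_shift (R : realType) (m k : nat) (x : R) :
  `|x| < 1 -> (k <= m)%N ->
  [series 'C(j + m - k, m)%:R * x ^+ j]_j @ \oo --> (1 - x) ^- m.+1 * x ^+ k.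
Proof.
move=> x1; elim: k => [|k IH] km.
  rewrite mulr1; have := @cvg_series_bin R m x x1.
  by under eq_fun do rewrite -[(_ + m)%N]subn0.
rewrite -cvg_shiftS /=.
suff -> : (fun n => [series 'C(j + m - k.+1, m)%:R * x ^+ j]_j n.+1) =
    (fun n => x * [series 'C(j + m - k, m)%:R * x ^+ j]_j n).
  by rewrite (exprS x) mulrCA; apply: cvgMl_tmp; apply: IH; exact: ltnW.
apply/funext => n; rewrite /series /= big_nat_recl //= add0n.
rewrite bin_small ?mul0r ?add0r; last by rewrite ltn_subrL (leq_trans _ km).
rewrite big_distrr /=; apply: eq_bigr => j _.
by rewrite addSn subSS exprS mulrCA.
Qed.

Lemma eulerianB_rec_gf (R : realType) (m : nat) :
  eulerianB_gf m (fun k => (eulerianB_rec m k)%:R : R).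
Proof.
split=> [k /eulerianB_rec_gt -> //|x x1].
rewrite (_ : [series _]_j = fun N => \sum_(0 <= k < m.+1)
    (eulerianB_rec m k)%:R * [series 'C(j + m - k, m)%:R * x ^+ j]_j N); last first.
  apply/funext => N; rewrite /series /=.
  under [RHS]eq_bigr do rewrite big_distrr /=.
  rewrite exchange_big /=; apply: eq_bigr => j _.
  rewrite -natrX eulerianB_rec_worpitzky natr_sum big_distrl /=.
  by apply: eq_bigr => k _; rewrite natrM mulrA.
rewrite big_distrr /= !big_mkord.
under eq_fun do rewrite big_mkord.
apply: cvg_big => [|k _]; first exact: add_continuous.
rewrite mulrCA; apply: cvgMl_tmp.
by apply: cvg_series_bin_shift => //; rewrite -ltnS.
Qed.

Lemma eulerianBP (R : realType) (m : nat) : eulerianB_gf m (eulerianB R m).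
Proof.
apply: (xgetPex _ (P := [set b : nat -> R | eulerianB_gf m b])).
exists (fun k => (eulerianB_rec m k)%:R); exact: eulerianB_rec_gf.
Qed.

(* Main.v *)
Require Import Defs.
From mathcomp Require Import all_boot all_order all_algebra all_fingroup.
From mathcomp Require Import all_classical all_reals all_analysis.
From mathcomp Require Import zify ring.

Import Order.TTheory GRing.Theory Num.Theory.

Local Open Scope ring_scope.

(** Both kinds of Eulerian numbers satisfy one recurrence with a parameter [d],
    namely
<<
      E_{M+1}(k) = (d k + 1) E_M(k) + (d (M + 1 - k) + 1) E_M(k - 1),
>>
    where [d = 2] gives type B in degree [M], and [d = 1] gives the numbers of
    permutations of [M + 1] letters with [k] descents; the latter follows by
    inserting the largest letter ([eulerianA_recE]).

    Since [(1 - x^2)^k (1 + x)^(2n-1-2k) = (1 + x)^(2n-1-k) (1 - x)^k], the inner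
    sum in the definition of [C_t] is the coefficient of [x^(2t+1)] in
    [(1 + x)^(M-k) (1 - x)^k], where [M = 2n - 1].  The symmetry
    [E_M(k) = E_M(M - k)] of the Eulerian numbers, together with the oddness of
    [M], makes the terms [k] and [M - k] contribute equally to odd coefficients,
    so [2 C_t] is the coefficient of [x^(2t+1)] in the full sum
<<
      H_M(x) = sum_(k <= M) (-1)^k E_M(k) (1 + x)^(M-k) (1 - x)^k,
>>
    a Cayley transform of the Eulerian polynomial ([calC_coef]).

    The recurrence of the [E_M] becomes [H_{M+1} = 2 x H_M - d (1 - x^2) H_M'].
    Hence the coefficients of [H_M] alternate in sign, and their absolute values
    satisfy the positive recurrence
<<
      h_{M+1}(j) = d (j + 1) h_M(j + 1) + (d (j - 1) + 2) h_M(j - 1)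
>>
    ([coef_cayley_eulerian]).  Its two weights are arithmetic progressions in [j]
    with the same step, and a recurrence of this kind preserves log-concavity
    along a parity class, by direct expansion ([linear_step_log_concave],
    [cayley_coef_log_concave]).  The [h_M(j)] with [j <= M] of the parity of [M]
    are positive, so log-concavity yields unimodality. *)

(** * A common recurrence for both types *)

(** At [k = k'.+1] the second weight is [d * (M'.+1 - k) + 1]; its truncated
    subtraction is exact whenever the number that it multiplies is nonzero, by
    [eulerian_gt]. *)
Fixpoint eulerian (d M k : nat) : nat :=
  if M is M'.+1 then
    ((d * k + 1) * eulerian d M' k +
     (if k is k'.+1 then (d * (M' - k') + 1) * eulerian d M' k' else 0))%N
  else (k == 0)%N.

Lemma eulerian_gt (d M k : nat) : (M < k)%N -> eulerian d M k = 0%N.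
Proof.
elim: M k => [|M IH] [|k] //= Mk.
by rewrite !IH ?muln0 //; apply: ltnW.
Qed.

Lemma eulerian_sym (d M k : nat) : (k <= M)%N -> eulerian d M (M - k) = eulerian d M k.
Proof.
elim: M k => [|M IH] [|k] //; rewrite ?ltnS => kM.
  rewrite subn0 /= subnn eulerian_gt // !muln0 !addn0 add0n mul1n.
  by rewrite -{2}(subn0 M) IH ?mul1n.
rewrite subSS; case: (ltnP k M) => [lt_kM|Mk].
  have -> : (M - k = (M - k.+1).+1)%N by lia.
  rewrite /= IH // (subnSK lt_kM) IH 1?ltnW // addnC.
  by rewrite subKn.
have -> : k = M by lia.
rewrite subnn /= (@eulerian_gt d M M.+1) // subnn.
rewrite muln0 !addn0 mul1n add0n muln0 add0n mul1n.
by rewrite -{3}(subn0 M) IH.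
Qed.

(** * Permutations counted by descents *)

(** A permutation as the word of its values, continued by [N].  When [N] exceeds
    every letter, this sentinel creates no descent at the last position, so that
    descents can be counted over all positions without a boundary case. *)
Definition word (N : nat) {m : nat} (s : 'S_m) (i : nat) : nat :=
  if insub i is Some i' then s i' else N.

Lemma word_ord (N m : nat) (s : 'S_m) (i : 'I_m) : word N s i = s i.
Proof. by rewrite /word valK. Qed.

Lemma word_out (N m : nat) (s : 'S_m) (i : nat) : (m <= i)%N -> word N s i = N.
Proof. by move=> mi; rewrite /word insubF // ltnNge mi. Qed.

Lemma word_lt (N m : nat) (s : 'S_m) (i : nat) : (i < m)%N -> (word N s i < m)%N.
Proof. by move=> im; rewrite -[i]/(val (Ordinal im)) word_ord. Qed.

Lemma card_descents (N m : nat) (s : 'S_m) : (m <= N)%N ->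
  #|descents s| = (\sum_(0 <= i < m) (word N s i.+1 < word N s i))%N.
Proof.
move=> mN; rewrite -sum1_card big_mkcond big_mkord; apply: eq_bigr => i _ /=.
rewrite inE word_ord; have [im|mi] := ltnP i.+1 m.
  rewrite -[i.+1]/(val (Ordinal im)) word_ord.
  case: existsP => [[j /andP[/eqP ji lt_s]]|no].
    by rewrite (_ : Ordinal im = j) ?lt_s //; apply: val_inj.
  by case: ltnP => // lt_s; case: no; exists (Ordinal im); rewrite eqxx.
rewrite word_out // ltnNge (leq_trans (ltnW (ltn_ord (s i))) mN) /=.
by case: existsP => // -[j /andP[/eqP ji _]]; have := ltn_ord j; lia.
Qed.

Lemma card_descents_le (m : nat) (s : 'S_m.+1) : (#|descents s| <= m)%N.
Proof.
rewrite (@card_descents m.+1) // big_nat_recr //= word_out //.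
have /ltnW/leq_gtF -> : (word m.+1 s m < m.+1)%N by rewrite word_lt.
rewrite addn0; apply: (@leq_trans (\sum_(0 <= i < m) 1)%N).
  by apply: leq_sum => i _; apply: leq_b1.
by rewrite sum_nat_const_nat subn0 muln1.
Qed.

Definition insert_at (i x : nat) (w : nat -> nat) (j : nat) : nat :=
  if (j < i)%N then w j else if j == i then x else w j.-1.

Lemma word_lift_perm (N m : nat) (i : 'I_m.+1) (s : 'S_m) :
  word N (lift_perm i ord_max s) =1 insert_at i m (word N s).
Proof.
move=> j; have [jm|mj] := ltnP j m.+1; last first.
  have im := ltn_ord i; rewrite word_out // /insert_at ltnNge.
  rewrite (_ : i <= j)%N /=; last lia.
  by rewrite gtn_eqF ?word_out //; lia.
rewrite -[j]/(val (Ordinal jm)); move: (Ordinal jm) => {jm} {}j.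
rewrite word_ord; have [k ->|->] := unliftP i j; last first.
  by rewrite lift_perm_id /insert_at ltnn eqxx.
rewrite lift_perm_lift lift_max -(word_ord N) /insert_at /= /bump.
case: (leqP i k) => ik; rewrite ?add1n ?add0n ?ik //=.
by rewrite ltnNge (leqW ik) gtn_eqF.
Qed.

(** Inserting a largest letter [x] at position [i] destroys the descent between
    the positions [i - 1] and [i], if there was one, and creates one in front of
    the former [i]-th letter, unless that letter is the sentinel. *)
Lemma descents_insert_at (m i x : nat) (w : nat -> nat) :
    (i <= m)%N -> (forall j, (j < i)%N -> (w j <= x)%N) ->
  (\sum_(0 <= j < m.+1) (insert_at i x w j.+1 < insert_at i x w j)
   + ((0 < i) && (w i < w i.-1)) =
   \sum_(0 <= j < m) (w j.+1 < w j) + (w i < x))%N.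
Proof.
case: i => [|i] im w_le.
  by rewrite big_nat_recl //= addn0 addnC; congr addn; apply: eq_bigr.
pose I j : nat := (insert_at i.+1 x w j.+1 < insert_at i.+1 x w j)%N.
pose D j : nat := (w j.+1 < w j)%N.
rewrite -[X in (X + _ = _)%N]/(\sum_(0 <= j < m.+1) I j)%N.
rewrite -[X in (_ = X + _)%N]/(\sum_(0 <= j < m) D j)%N.
have ins_lt a : (a < i.+1)%N -> insert_at i.+1 x w a = w a.
  by rewrite /insert_at => ->.
have ins_eq : insert_at i.+1 x w i.+1 = x by rewrite /insert_at ltnn eqxx.
have ins_gt a : (i.+1 < a)%N -> insert_at i.+1 x w a = w a.-1.
  by move=> ia; rewrite /insert_at ltnNge (ltnW ia) gtn_eqF.
have lo j : (j < i)%N -> I j = D j.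
  by move=> ji; rewrite /I !ins_lt // ltnW.
have hi j : (i < j)%N -> I j.+1 = D j.
  by move=> ij; rewrite /I !ins_gt // ltnW.
have Ii : I i = 0%N by rewrite /I ins_eq ins_lt // ltnNge w_le.
have Ii1 : I i.+1 = (w i.+1 < x)%N by rewrite /I ins_eq ins_gt.
have -> : (\sum_(0 <= j < m.+1) I j = \sum_(0 <= j < i) D j
    + (I i + (I i.+1 + \sum_(i.+1 <= j < m) D j)))%N.
  rewrite (big_cat_nat (leq0n i) (leqW (ltnW im))) /=; congr addn.
    by apply: eq_big_nat => j /andP[_ /lo].
  rewrite big_ltn ?leqW // big_ltn ?ltnS // big_add1 /=; congr (_ + (_ + _))%N.
  by apply: eq_big_nat => j /andP[/hi].
have -> : (\sum_(0 <= j < m) D j = \sum_(0 <= j < i) D j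
    + (D i + \sum_(i.+1 <= j < m) D j))%N.
  by rewrite (big_cat_nat (leq0n i) (ltnW im)) /= [X in (_ + X)%N]big_ltn.
by rewrite Ii Ii1 /= /D; lia.
Qed.

(** The insertions that keep the number of descents are those into a descent and
    the one at the very end, where no descent is destroyed or created. *)
Lemma count_insert_at (m : nat) (w : nat -> nat) :
    (forall j, (j <= m)%N -> (w j <= m)%N) -> (m < w m.+1)%N ->
  (\sum_(0 <= i < m.+2) (((0 < i) && (w i < w i.-1)) == (w i < m.+1) :> bool)
    = (\sum_(0 <= i < m.+1) (w i.+1 < w i)).+1)%N.
Proof.
move=> w_in w_out.
have lastF : (w m.+1 < w m)%N = false by apply/negbTE; have := w_in m (leqnn m); lia.
have outF : (w m.+1 < m.+1)%N = false by lia.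
rewrite big_nat_recr //= lastF outF eqxx addn1; congr _.+1.
rewrite big_nat_recl //= [RHS]big_nat_recr //= lastF addn0 ltnS w_in // add0n.
by apply: eq_big_nat => i im; rewrite ltnS w_in // eqb_id.
Qed.

Lemma lift_perm_bij (m : nat) (j : 'I_m.+1) :
  bijective (fun p : 'I_m.+1 * 'S_m => lift_perm p.1 j p.2).
Proof.
apply: inj_card_bij => [[i s] [i' s'] /= e|]; last first.
  by rewrite card_prod card_ord !card_Sn factS.
have ii : i = i'.
  by apply: (@perm_inj _ (lift_perm i j s)); rewrite {2}e !lift_perm_id.
subst i'; congr pair; apply/permP => k.
by apply: (@lift_inj _ j); rewrite -!(lift_perm_lift i) e.
Qed.

Lemma descents_lift_perm (m : nat) (i : 'I_m.+1) (s : 'S_m) :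
  let w := word m.+1 s in
  (#|descents (lift_perm i ord_max s)| + ((0 < i) && (w i < w i.-1))
   = #|descents s| + (w i < m))%N.
Proof.
move=> w; have im : (i <= m)%N by rewrite -ltnS.
rewrite !(@card_descents m.+1) // -(descents_insert_at m i m) //; last first.
  by move=> j ji; rewrite ltnW // word_lt // (leq_trans ji).
congr addn; apply: eq_bigr => j _.
by rewrite !word_lift_perm.
Qed.

(** Of the [m + 2] ways to insert a largest letter into a word with [D] descents,
    [D + 1] keep the number of descents and the others raise it by one; this is
    the Eulerian recurrence, read off one permutation at a time. *)
Lemma card_descents_lift_perm (m k : nat) (s : 'S_m.+1) :
  let D := #|descents s| in
  (\sum_(i < m.+2) (#|descents (lift_perm i ord_max s)| == k) =
   (D == k) * k.+1 + (D.+1 == k) * (m.+1 - D))%N.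
Proof.
move=> D; pose w := word m.+2 s.
(* [c i] says that inserting at [i] keeps the number of descents. *)
pose c i : bool := ((0 < i)%N && (w i < w i.-1)%N) == (w i < m.+1)%N.
have w_out : (m < w m.+1)%N by rewrite /w word_out.
have sum_c : (\sum_(0 <= i < m.+2) c i = D.+1)%N.
  rewrite /c count_insert_at //; last by move=> j jm; rewrite -ltnS word_lt.
  by rewrite /D (@card_descents m.+2).
have sum_cC : (\sum_(0 <= i < m.+2) ~~ c i = m.+1 - D)%N.
  rewrite -subSS -sum_c; apply/eqP; rewrite -(eqn_add2r (\sum_(0 <= i < m.+2) c i)).
  rewrite -big_split /= (eq_bigr (fun=> 1%N)); last by move=> i _; case: (c i).
  rewrite sum_nat_const_nat subn0 muln1 subnK // -[X in (_ <= X)%N](subn0 m.+2).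
  rewrite -[X in (_ <= X)%N]muln1 -sum_nat_const_nat leq_sum // => i _.
  by case: (c i).
transitivity (\sum_(0 <= i < m.+2) ((D == k) * c i + (D.+1 == k) * ~~ c i))%N.
  rewrite big_mkord; apply: eq_bigr => i _.
  have := descents_lift_perm m.+1 i s; rewrite -/w -/D /c /=.
  have : ~~ (w i < m.+1)%N -> (0 < i)%N && (w i < w i.-1)%N = false.
    rewrite -leqNgt => wi; apply/negbTE; rewrite negb_and -leqNgt leqn0.
    case: (posnP i) => //= i0; rewrite -leqNgt (leq_trans _ wi) // ltnW // word_lt //.
    by have := ltn_ord i; lia.
  set q := #|_|; case: (w i < m.+1)%N; case: (_ && _) => //= H e; try by have := H isT.
  - by rewrite (_ : q = D); lia.
  - by rewrite (_ : q = D.+1); lia.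
  - by rewrite (_ : q = D); lia.
rewrite big_split /= -!big_distrr /= sum_c sum_cC; congr addn.
by case: eqP => // ->.
Qed.

(** Every permutation of [m + 2] letters arises exactly once by inserting the
    largest letter, so summing [card_descents_lift_perm] gives the recurrence. *)
Lemma eulerianA_recE (m k : nat) : eulerianA m.+1 k = eulerian 1 m k.
Proof.
have sumE p l : eulerianA p l = (\sum_(s : 'S_p) (#|descents s| == l))%N.
  rewrite /eulerianA -sum1_card big_mkcond; apply: eq_bigr => s _.
  (* The comprehension in [eulerianA] denotes a classical set, not a [{set _}]. *)
  suff -> : (s \in [set s0 : 'S_p | #|descents s0| == l]%classic)
      = (#|descents s| == l).
    by case: eqP.
  by apply/idP/idP => [/set_mem|h]; last exact: mem_set.
elim: m k => [|m IH] k.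
  rewrite sumE /= (eq_bigr (fun=> (k == 0) : nat)) => [|s _].
    by rewrite sum_nat_const card_Sn mul1n.
  rewrite (@card_descents 1) // big_nat1 word_out // ltnNge ltnW ?word_lt //=.
  by rewrite eq_sym.
rewrite sumE (reindex _ (onW_bij _ (lift_perm_bij m.+1 ord_max))) /=.
rewrite -(pair_bigA _ (fun i s =>
  nat_of_bool (#|descents (lift_perm i ord_max s)| == k))) /=.
rewrite exchange_big /=.
under eq_bigr do rewrite card_descents_lift_perm.
rewrite big_split /= -big_distrl /= -sumE IH mulnC mul1n addn1; congr addn.
case: k => [|k]; first by rewrite big1.
rewrite mul1n addn1 mulnC -IH sumE big_distrl /=; apply: eq_bigr => s _.
rewrite eqSS; case: eqP => [<-|_]; last by rewrite !mul0n.
by rewrite subSn // card_descents_le.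
Qed.

(** * The Cayley transform of the Eulerian polynomials *)

(** This is [(1 + x)^M * E_M (- (1 - x) / (1 + x))], where [E_M] is the polynomial
    with coefficients [eulerian d M k]. *)
Definition cayley_eulerian (R : comNzRingType) (d M : nat) : {poly R} :=
  \sum_(0 <= k < M.+1) (-1) ^+ k * (eulerian d M k)%:R *
    ((1 + 'X) ^+ (M - k) * (1 - 'X) ^+ k).

Lemma deriv_cayley_monomial (R : comNzRingType) (a b : nat) :
  (1 - 'X ^+ 2) * ((1 + 'X) ^+ a * (1 - 'X) ^+ b)^`() =
  (1 + 'X) ^+ a * (1 - 'X) ^+ b * (a%:R * (1 - 'X) - b%:R * (1 + 'X)) :> {poly R}.
Proof.
have -> : 1 - 'X ^+ 2 = (1 + 'X) * (1 - 'X) :> {poly R} by rewrite mulrC -subr_sqr expr1n.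
have dp : (1 + 'X)^`() = 1 :> {poly R} by rewrite derivD derivX -polyC1 derivC add0r.
have dq : (1 - 'X)^`() = -1 :> {poly R} by rewrite derivB derivX -polyC1 derivC sub0r.
have mul_exp_pred (u : {poly R}) k : u * (u ^+ k.-1 *+ k) = k%:R * u ^+ k.
  by case: k => [|k]; rewrite ?mulr0n ?mulr0 ?mul0r // mulrnAr -exprS mulr_natl.
have collect (T : comNzRingType) (p q P Q dP dQ x y : T) :
    p * dP = x * P -> q * dQ = y * Q ->
  p * q * (dP * Q + P * - dQ) = P * Q * (x * q - y * p).
  move=> eP eQ; transitivity (p * dP * (q * Q) - q * dQ * (p * P)); first by ring.
  by rewrite eP eQ; ring.
rewrite derivM !deriv_exp dp dq mul1r mulN1r mulNrn.
exact: collect (mul_exp_pred _ a) (mul_exp_pred _ b).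
Qed.

(** By [deriv_cayley_monomial], both sides are the sum over [k] of
    [(-1)^k E_M(k) p^(M-k) q^k ((d k + 1) p - (d (M - k) + 1) q)] with [p = 1 + x]
    and [q = 1 - x]: on the left after collecting the two terms of the Eulerian
    recurrence, on the right because [2 x = p - q]. *)
Lemma cayley_eulerian_rec (R : comNzRingType) (d M : nat) :
  cayley_eulerian R d M.+1 =
    2%:R * 'X * cayley_eulerian R d M
    - d%:R * ((1 - 'X ^+ 2) * (cayley_eulerian R d M)^`()).
Proof.
pose p : {poly R} := 1 + 'X; pose q : {poly R} := 1 - 'X.
transitivity (\sum_(0 <= k < M.+1)
    (-1) ^+ k * (eulerian d M k)%:R * (p ^+ (M - k) * q ^+ k)
    * ((d%:R * k%:R + 1) * p - (d%:R * (M - k)%:R + 1) * q)).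
  rewrite /cayley_eulerian (eq_bigr (fun k =>
      (-1) ^+ k * ((d * k + 1) * eulerian d M k)%:R * (p ^+ (M.+1 - k) * q ^+ k)
    + (-1) ^+ k *
      (if k is k'.+1 then (d * (M - k') + 1) * eulerian d M k' else 0)%:R *
      (p ^+ (M.+1 - k) * q ^+ k))); last first.
    by move=> k _; rewrite natrD mulrDr mulrDl.
  rewrite big_split /= big_nat_recr //= [X in _ + X]big_nat_recl //=.
  rewrite eulerian_gt // muln0 !mulr0 !mul0r addr0 add0r -big_split /=.
  apply: eq_big_nat => k /andP[_]; rewrite ltnS => kM.
  have collect (T : comNzRingType) (c e P Q u v x y : T) :
      c * (x * e) * (u * P * Q) + -1 * c * (y * e) * (P * (v * Q))
      = c * e * (P * Q) * (x * u - y * v) by ring.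
  by rewrite subSS subSn // !natrM !natrD !natrM !exprS; apply: collect.
have collect (T : comNzRingType) (x c P y z w : T) :
    c * P * ((w * z + 1) * (1 + x) - (w * y + 1) * (1 - x)) =
    2%:R * x * (c * P) - w * (c * (P * (y * (1 - x) - z * (1 + x)))) by ring.
rewrite /cayley_eulerian raddf_sum !big_distrr /= -sumrB.
apply: eq_bigr => k _.
have -> : (-1) ^+ k * (eulerian d M k)%:R =
      ((-1) ^+ k * (eulerian d M k)%:R)%:P :> {poly R}.
  by rewrite polyCM polyC_exp polyCN polyC1 polyC_natr.
rewrite [(_%:P * _)^`()]derivM derivC mul0r add0r [(1 - 'X^2) * _]mulrCA.
by rewrite deriv_cayley_monomial; apply: collect.
Qed.

(** The recurrence [cayley_eulerian_rec] read on coefficients, with the minus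
    signs removed. *)
Fixpoint cayley_coef (d M j : nat) : nat :=
  if M is M'.+1 then
    (d * j.+1 * cayley_coef d M' j.+1 +
     (if j is j'.+1 then (d * j' + 2) * cayley_coef d M' j' else 0))%N
  else (j == 0)%N.

(** For [M - j] even, the sign is [(-1)^((M - j)/2)], and the other coefficients
    vanish; [M + 3 j] replaces [M - j], to which it is congruent modulo 4, to avoid
    truncated subtraction. *)
Lemma coef_cayley_eulerian (R : comNzRingType) (d M j : nat) :
  (cayley_eulerian R d M)`_j = (-1) ^+ ((M + 3 * j)./2) * (cayley_coef d M j)%:R.
Proof.
elim: M j => [|M IH] j.
  rewrite /cayley_eulerian big_nat1 /= !expr0 !mulr1 coef1 add0n.
  by case: j => [|j]; rewrite ?muln0 ?expr0 ?mulr1 //= mulr0.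
have half_up i : ((M + 3 * i.+1)./2 = ((M.+1 + 3 * i)./2).+1)%N by lia.
rewrite cayley_eulerian_rec -mulrA -!polyC_natr coefB !coefCM coefXM.
rewrite mulrBl mul1r coefB coef_deriv.
case: j => [|j].
  rewrite coefXnM mulr0 sub0r subr0 mulr1n IH half_up exprS mulN1r.
  by rewrite [cayley_coef _ _ 0]/= addn0 muln1 natrM mulNr mulrN opprK mulrCA.
have half_dn : ((M.+1 + 3 * j.+1)./2 = ((M + 3 * j)./2).+2)%N by lia.
have -> : ('X^2 * (cayley_eulerian R d M)^`())`_j.+1 = (cayley_eulerian R d M)`_j *+ j.
  rewrite coefXnM; case: (j) => [|i] //=.
  by rewrite !subSS subn0 coef_deriv.
have collect (T : comNzRingType) (sg h h' x y z : T) :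
    2%:R * (sg * h') - x * (-1 * (-1 * (-1 * sg)) * h * y - sg * h' * z)
    = -1 * (-1 * sg) * (x * y * h + (x * z + 2%:R) * h') by ring.
rewrite -[_ *+ j.+2]mulr_natr -[_ *+ j]mulr_natr !IH half_up half_dn !exprS.
rewrite [cayley_coef _ M.+1 _]/=.
by rewrite !natrD !natrM natrD natrM; apply: collect.
Qed.

Lemma coef_comp_polyN (R : comNzRingType) (p : {poly R}) (l : nat) :
  (p \Po (- 'X))`_l = (-1) ^+ l * p`_l.
Proof.
elim/poly_ind: p l => [|p c IH] l; first by rewrite comp_poly0 coef0 mulr0.
rewrite comp_polyD comp_polyM comp_polyX comp_polyC mulrN !coefD coefN !coefMX !coefC.
case: l => [|l] /=; first by rewrite oppr0 mul1r.
by rewrite IH exprS !addr0; ring.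
Qed.

Lemma coef_binz (R : comNzRingType) (a l i : nat) :
  ('X ^+ i * (1 + 'X) ^+ a : {poly R})`_l = (binz a (l%:Z - i%:Z))%:R.
Proof.
rewrite coefXnM; case: ltnP => li.
  by have -> : l%:Z - i%:Z = Negz (i - l).-1 by lia.
rewrite subzn //=.
have -> : (1 + 'X) ^+ a = \poly_(j < a.+1) 'C(a, j)%:R :> {poly R}.
  rewrite exprDn poly_def; apply: eq_bigr => j _.
  by rewrite expr1n mul1r -scaler_nat.
by rewrite coef_poly; case: ltnP => // al; rewrite bin_small.
Qed.

(** The term [M - k] of [cayley_eulerian] is the term [k] at [- x] up to the sign
    [(-1)^M = -1], so both have the same odd coefficients; the definition of [calC]
    keeps one term of each pair. *)
Lemma calC_coef (R : realType) (d n t : nat) : (0 < n)%N ->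
  2%:R * calC (fun k => (eulerian d (2 * n - 1) k)%:R : R) n t
  = (cayley_eulerian R d (2 * n - 1))`_(2 * t + 1).
Proof.
move=> n0; set m := (2 * n - 1)%N.
pose u k : {poly R} := (1 + 'X) ^+ (m - k) * (1 - 'X) ^+ k.
have inner k : (k < n)%N -> \sum_(0 <= i < k.+1) (-1) ^+ i * 'C(k, i)%:R *
    (binz (2 * n - 2 * k - 1) ((2 * t)%:Z - (2 * i)%:Z + 1))%:R = (u k)`_(2 * t + 1).
  move=> kn; have -> : u k = (1 - 'X ^+ 2) ^+ k * (1 + 'X) ^+ (2 * n - 2 * k - 1).
    have -> : (1 - 'X ^+ 2 : {poly R}) = (1 + 'X) * (1 - 'X) by ring.
    rewrite exprMn /u (_ : m - k = k + (2 * n - 2 * k - 1))%N; last lia.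
    by rewrite exprD; ring.
  rewrite exprBn big_distrl /= coef_sum big_mkord; apply: eq_bigr => i _.
  rewrite expr1n mulr1 -exprM.
  have -> : ((-1) ^+ i * 'X ^+ (2 * i) *+ 'C(k, i)
      * (1 + 'X) ^+ (2 * n - 2 * k - 1) : {poly R}) =
    ((-1) ^+ i * 'C(k, i)%:R)%:P * ('X ^+ (2 * i) * (1 + 'X) ^+ (2 * n - 2 * k - 1)).
    by rewrite polyCM polyC_exp polyCN polyC1 polyC_natr -mulr_natl; ring.
  rewrite coefCM coef_binz; congr (_ * (binz _ _)%:R); lia.
have refl k : (k <= m)%N -> (u (m - k)%N)`_(2 * t + 1) = - (u k)`_(2 * t + 1).
  move=> km; have -> : u (m - k)%N = u k \Po - 'X.
    rewrite /u subKn // comp_polyM !rmorphXn /= comp_polyD comp_polyB comp_polyX.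
    by rewrite -polyC1 comp_polyC opprK mulrC.
  by rewrite coef_comp_polyN -signr_odd (_ : odd _ = true) ?expr1 ?mulN1r //; lia.
pose F k : R := (-1) ^+ k * (eulerian d m k)%:R * (u k)`_(2 * t + 1).
have -> : (cayley_eulerian R d m)`_(2 * t + 1) = \sum_(0 <= k < m.+1) F k.
  rewrite /cayley_eulerian coef_sum; apply: eq_bigr => k _.
  have -> : (-1) ^+ k * (eulerian d m k)%:R =
      ((-1) ^+ k * (eulerian d m k)%:R)%:P :> {poly R}.
    by rewrite polyCM polyC_exp polyCN polyC1 polyC_natr.
  by rewrite coefCM.
rewrite (@big_cat_nat _ _ _ n) //=; last lia.
have -> : \sum_(n <= k < m.+1) F k = \sum_(0 <= k < n) F (m - k)%N.
  rewrite big_nat_rev /= -{1}(add0n n) big_addn (_ : m.+1 - n = n)%N; last lia.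
  by apply: eq_bigr => k _; congr F; lia.
have -> : \sum_(0 <= k < n) F (m - k)%N = \sum_(0 <= k < n) F k.
  apply: eq_big_nat => k /andP[_ kn]; have km : (k <= m)%N by lia.
  rewrite /F eulerian_sym // refl //.
  have -> : (-1) ^+ (m - k)%N = - (-1) ^+ k :> R.
    rewrite -signr_odd -[in RHS]signr_odd (_ : odd (m - k) = ~~ odd k); last lia.
    by case: (odd k); rewrite ?opprK.
  by ring.
rewrite -mulr2n -[RHS]mulr_natl; congr (_ * _).
apply: eq_big_nat => k /andP[_ kn].
by rewrite inner // /F [_ * (-1) ^+ k]mulrC.
Qed.

(** * Log-concavity of the coefficients *)

(** Think of [w, x, y, z] as consecutive entries of a log-concave sequence, and
    of [f, f + s, f + 2 s] and [g, g + s, g + 2 s] as the weights of a two-term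
    recurrence.  The product of the outer weights falls short of the square of the
    middle one by [s ^ 2], and after using the hypotheses the surplus is exactly
    [(s * (x + y)) ^ 2]. *)
Lemma linear_step_log_concave (f g s w x y z : nat) :
  (w * y <= x * x)%N -> (x * z <= y * y)%N -> (w * z <= x * y)%N ->
  ((f * w + g * x) * ((f + 2 * s) * y + (g + 2 * s) * z)
   <= ((f + s) * x + (g + s) * y) ^ 2)%N.
Proof.
move=> wy xz wz.
have h1 := leq_mul (leqnn (f * (f + 2 * s))%N) wy.
have h2 := leq_mul (leqnn (g * (g + 2 * s))%N) xz.
have h3 := leq_mul (leqnn (f * (g + 2 * s))%N) wz.
have -> : ((f * w + g * x) * ((f + 2 * s) * y + (g + 2 * s) * z) =
  f * (f + 2 * s) * (w * y) + g * (g + 2 * s) * (x * z)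
  + f * (g + 2 * s) * (w * z) + g * (f + 2 * s) * (x * y))%N by ring.
have -> : (((f + s) * x + (g + s) * y) ^ 2 =
  f * (f + 2 * s) * (x * x) + g * (g + 2 * s) * (y * y)
  + f * (g + 2 * s) * (x * y) + g * (f + 2 * s) * (x * y)
  + (s * (x + y)) ^ 2)%N by rewrite -!mulnn; ring.
lia.
Qed.

Lemma cayley_coef_gt (d M j : nat) : (M < j)%N -> cayley_coef d M j = 0%N.
Proof.
elim: M j => [|M IH] [|j] //= Mj.
by rewrite !IH ?muln0 // ltnW // ltnW.
Qed.

Lemma cayley_coef_odd (d M j : nat) : odd (M + j) -> cayley_coef d M j = 0%N.
Proof.
elim: M j => [|M IH] [|j] //= Mj; rewrite !IH ?muln0 //; lia.
Qed.

Lemma cayley_coef_gt0 (d M j : nat) :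
  (0 < d)%N -> ~~ odd (M + j) -> (j <= M)%N -> (0 < cayley_coef d M j)%N.
Proof.
move=> d0; elim: M j => [|M IH] [|j] //= Mj jM.
  by rewrite addn0 !muln_gt0 d0 IH //; lia.
by rewrite addn_gt0 [X in _ || X]muln_gt0 IH ?addn2 ?orbT //; lia.
Qed.

(** The proof is by induction on [M], with [linear_step_log_concave] applied to the
    entries of indices [j - 1, j + 1, j + 3, j + 5], whose weights have common
    step [2 d]. *)
Lemma cayley_coef_log_concave (d M j : nat) : (0 < d)%N ->
  (cayley_coef d M j * cayley_coef d M j.+4 <= cayley_coef d M j.+2 ^ 2)%N.
Proof.
move=> d0; elim: M j => [|M IH] j; first by rewrite muln0.
(* The hypothesis on the outer pair is the product of two instances of the
   induction hypothesis, divided by the middle entries; this needs the support of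
   the sequence to have no gaps. *)
have far i : (cayley_coef d M i * cayley_coef d M i.+2.+4
    <= cayley_coef d M i.+2 * cayley_coef d M i.+4)%N.
  have [/cayley_coef_odd -> //|ev] := boolP (odd (M + i)).
  have [/cayley_coef_gt -> |iM] := ltnP M i.+2.+4; first by rewrite muln0.
  have p2 : (0 < cayley_coef d M i.+2)%N.
    by apply: cayley_coef_gt0 => //; lia.
  have p4 : (0 < cayley_coef d M i.+4)%N.
    by apply: cayley_coef_gt0 => //; lia.
  have := leq_mul (IH i) (IH i.+2).
  move: p2 p4; set a := cayley_coef _ _ _; set b := cayley_coef _ _ _.
  move: (cayley_coef d M i) (cayley_coef d M i.+2.+4) => u v a0 b0.
  rewrite -!mulnn => le_ab.
  by rewrite -(@leq_pmul2r (a * b)) ?muln_gt0 ?a0 //; lia.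
(* At the border there is no entry of index [j - 1], whose weight [2 - d] might be
   negative. *)
case: j => [|j] /=.
  have := leq_mul (leqnn (5 * (d * d))%N) (IH 1%N).
  move: (cayley_coef d M 1) (cayley_coef d M 3) (cayley_coef d M 5) => x y z xz.
  have -> : ((d * 1 * x + 0) * (d * 5 * z + (d * 3 + 2) * y) =
    5 * (d * d) * (x * z) + (3 * (d * d) + 2 * d) * (x * y))%N by ring.
  have -> : ((d * 3 * y + (d * 1 + 2) * x) ^ 2 =
    5 * (d * d) * y ^ 2 + 4 * (d * d) * (y * y)
    + (6 * (d * d) + 12 * d) * (x * y) + (d + 2) ^ 2 * (x * x))%N.
    by rewrite -!mulnn; ring.
  have : ((3 * (d * d) + 2 * d) * (x * y) <= (6 * (d * d) + 12 * d) * (x * y))%N.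
    by rewrite leq_mul // leq_add // leq_mul.
  by lia.
have := @linear_step_log_concave (d * j + 2) (d * j.+2) (2 * d)
  (cayley_coef d M j) (cayley_coef d M j.+2)
  (cayley_coef d M j.+4) (cayley_coef d M j.+2.+4).
rewrite !mulnn => /(_ (IH j) (IH j.+2) (far j)); congr leq; last congr expn; ring.
Qed.

Lemma log_concave_unimodal (R : realType) (N : nat) (a : nat -> R) :
  (forall t, (t <= N)%N -> 0 < a t) -> log_concave N a -> unimodal N a.
Proof.
move=> a_gt0 lc.
have exP : exists t, (N <= t)%N || (a t.+1 <= a t) by exists N; rewrite leqnn.
(* The peak is the first index at which the sequence stops increasing. *)
pose p := ex_minn exP; exists (minn p N); first exact: geq_minr.
rewrite /p; case: ex_minnP => q qP q_min; split=> [t|t].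
  rewrite leq_min => /andP[tq tN]; rewrite leNgt; apply/negP => lt_a.
  by move: tq; rewrite ltnNge q_min // (ltW lt_a) orbT.
elim: t => [|t IH] qt tN.
  have q0 : q = 0%N by lia.
  by move: qP; rewrite q0 leqNgt tN.
have [tq|/IH/(_ (ltnW tN)) le_a] := ltnP t (minn q N).
  have qE : q = t.+1 by lia.
  by move: qP; rewrite qE leqNgt tN.
(* A weak descent propagates: log-concavity at [t.+1], divided by [a t > 0]. *)
have := lc t.+1 isT; rewrite /= => /(_ ltac:(lia)) lct.
rewrite -(ler_pM2l (a_gt0 t ltac:(lia))); apply: le_trans lct _.
by rewrite expr2 ler_pM2r // a_gt0 // ltnW.
Qed.

(** * The two families *)

Lemma norm_calC_eulerian (R : realType) (d n t : nat) : (0 < n)%N ->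
  `|calC (fun k => (eulerian d (2 * n - 1) k)%:R : R) n t|
  = (cayley_coef d (2 * n - 1) (2 * t + 1))%:R / 2%:R.
Proof.
move=> n0; have two_gt0 : 0 < 2%:R :> R by rewrite ltr0n.
apply: (mulfI (lt0r_neq0 two_gt0)); rewrite mulrCA divff ?lt0r_neq0 // mulr1.
rewrite -{1}(gtr0_norm two_gt0) -normrM calC_coef // coef_cayley_eulerian normrM normrX.
by rewrite normrN1 expr1n mul1r normr_nat.
Qed.

Lemma calC_eulerian_log_concave_unimodal (R : realType) (d n : nat) :
    (0 < d)%N -> (0 < n)%N ->
  let C := calC (fun k => (eulerian d (2 * n - 1) k)%:R : R) n in
  log_concave (n - 1) (fun t => `|C t|) /\ unimodal (n - 1) (fun t => `|C t|).
Proof.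
move=> d0 n0 C.
have lc : log_concave (n - 1) (fun t => `|C t|).
  move=> [//|t] _ _ /=; rewrite !norm_calC_eulerian // mulrACA -expr2 exprMn.
  rewrite ler_pM2r ?exprn_gt0 ?invr_gt0 ?ltr0n // -natrM -natrX ler_nat.
  have -> : (2 * t.+1 + 1 = (2 * t + 1).+2)%N by lia.
  have -> : (2 * t.+2 + 1 = (2 * t + 1).+4)%N by lia.
  exact: cayley_coef_log_concave.
split=> //; apply: log_concave_unimodal => // t tn.
rewrite norm_calC_eulerian // divr_gt0 ?ltr0n //.
by apply: cayley_coef_gt0 => //; lia.
Qed.

Lemma eulerianB_recE (R : realType) (m : nat) :
  eulerianB R m = fun k => (eulerian 2 m k)%:R.
Proof.
rewrite (eulerianB_gf_uniq (eulerianBP R m) (eulerianB_rec_gf R m)).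
apply/funext => k; congr _%:R.
by elim: m k => [|m IH] [|k] //=; rewrite !IH.
Qed.

Theorem corollary9p4 (R : realType) (n : nat) (hn : (2 <= n)%N) :
  (log_concave (n - 1) (fun t : nat => `|calCB R n t|) /\
   unimodal (n - 1) (fun t : nat => `|calCB R n t|)) /\
  (log_concave (n - 1) (fun t : nat => `|calCA R n t|) /\
   unimodal (n - 1) (fun t : nat => `|calCA R n t|)).
Proof.
have n0 : (0 < n)%N by exact: ltnW.
rewrite /calCB /calCA eulerianB_recE.
have -> : (fun k => (eulerianA (2 * n) k)%:R : R)
  = fun k => (eulerian 1 (2 * n - 1) k)%:R.
  apply/funext => k; rewrite -eulerianA_recE.
  by congr (eulerianA _ _)%:R; lia.
by split; apply: calC_eulerian_log_concave_unimodal.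
Qed.
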